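(* Let $\mathbf{Bun}$ be the category whose objects are bundles $(E,p,B)$ and whose morphisms are bundle morphisms. Let $\mathcal{P}$ be the choice of subobjects given by the relation of being a subbundle, that is, $\mathcal{P}$ has as objects all bundles, and it has a morphism from $(E',p',B')$ to $(E,p,B)$ exactly when $(E',p',B')$ is a subbundle of $(E,p,B)$, in which case that morphism is the inclusion $(j_{E'}^{E}, j_{B'}^{B})$. Then $(\mathbf{Bun},\mathcal{P})$ is a category with subobjects.
   Context: Composition convention: composites are written in diagrammatic (left-to-right) order, so $fg$ means ''first $f$, then $g$''. The class of objects of a category $\mathcal{C}$ is denoted $\nu\mathcal{C}$. Spaces are topological spaces and maps are continuous maps. Bundles: A bundle is a triple $(E,p,B)$ where $E$ (the total space) and $B$ (the base space) are spaces and $p:E\to B$ is a map (no local triviality or surjectivity is assumed). A bundle morphism $(u,f):(E,p,B)\to(E',p',B')$ is a pair of maps $u:E\to E'$ and $f:B\to B'$ with $up'=pf$ (i.e. $p'(u(x))=f(p(x))$ for all $x\in E$). The composite of $(u,f):(E,p,B)\to(E',p',B')$ and $(u',f'):(E',p',B')\to(E'',p'',B'')$ is $(uu',ff')$, and the identity of $(E,p,B)$ is $(1_E,1_B)$. These data form the category $\mathbf{Bun}$. Subbundles: A bundle $(E',p',B')$ is a subbundle of $(E,p,B)$ if $E'$ is a subspace of $E$, $B'$ is a subspace of $B$, and $p'=p|_{E'}:E'\to B'$. The inclusion of the subbundle is the bundle morphism $(j_{E'}^{E},j_{B'}^{B}):(E',p',B')\to(E,p,B)$, where $j_{E'}^{E}:E'\to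 E$ and $j_{B'}^{B}:B'\to B$ are the inclusion maps. Categories with subobjects: A preorder is a category $\mathcal{P}$ in which every hom-set $\mathcal{P}(p,p')$ has at most one element; the relation on $\nu\mathcal{P}$ given by $p\subseteq p' \Leftrightarrow \mathcal{P}(p,p')\neq\emptyset$ is then a quasiorder, and $\mathcal{P}$ is a strict preorder if this relation is antisymmetric. A morphism $f$ of a category $\mathcal{C}$ is a monomorphism if $gf=hf$ implies $g=h$ for all $g,h\in\mathcal{C}$ for which these composites are defined. A choice of subobjects in a category $\mathcal{C}$ is a subcategory $\mathcal{P}\subseteq\mathcal{C}$ such that: (a) $\mathcal{P}$ is a strict preorder with $\nu\mathcal{P}=\nu\mathcal{C}$; (b) every $f\in\mathcal{P}$ is a monomorphism in $\mathcal{C}$; (c) if $f,g\in\mathcal{P}$ and $f=hg$ for some $h\in\mathcal{C}$, then $h\in\mathcal{P}$. When $\mathcal{P}$ satisfies these conditions, the pair $(\mathcal{C},\mathcal{P})$ is called a category with subobjects. *)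

(* Defs.v *)
From HB Require Import structures.
From mathcomp Require Import all_boot.
From mathcomp Require Import all_classical topology.

Set Implicit Arguments.
Unset Strict Implicit.
Unset Printing Implicit Defensive.

Local Open Scope classical_set_scope.

(** * Categories *)

(* Composition is diagrammatic: [f ;; g] is first [f], then [g]. *)
Record category := Category {
  ob :> Type;
  hom : ob -> ob -> Type;
  idm : forall x, hom x x;
  cmp : forall x y z, hom x y -> hom y z -> hom x z;
  cmpA : forall w x y z (f : hom w x) (g : hom x y) (h : hom y z),
    cmp f (cmp g h) = cmp (cmp f g) h;
  cmp1l : forall x y (f : hom x y), cmp (idm x) f = f;
  cmp1r : forall x y (f : hom x y), cmp f (idm y) = f
}.
Arguments hom {c} x y.
Arguments idm {c} x.
Arguments cmp {c x y z} f g.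

Notation "f ;; g" := (cmp f g) (at level 50, left associativity).

Definition monomorphism (C : category) (x y : C) (f : hom x y) : Prop :=
  forall (z : C) (g h : hom z x), g ;; f = h ;; f -> g = h.

Definition preorder (P : category) : Prop :=
  forall (p p' : P) (f g : hom p p'), f = g.

Definition strict_preorder (P : category) : Prop :=
  preorder P /\
  forall p p' : P, inhabited (hom p p') -> inhabited (hom p' p) -> p = p'.

(* A class of objects together with a class of morphisms; it is a subcategory
   when [is_subcategory] holds. *)
Record subclass (C : category) := Subclass {
  sob : set C;
  smor : forall x y : C, set (hom x y)
}.
Arguments smor {C} s {x y}.

Record is_subcategory (C : category) (P : subclass C) : Prop := IsSubcategory {
  smor_ob : forall (x y : C) (f : hom x y), smor P f -> sob P x /\ sob P y;
  smor_id : forall x : C, sob P x -> smor P (idm x);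
  smor_cmp : forall (x y z : C) (f : hom x y) (g : hom y z),
    smor P f -> smor P g -> smor P (f ;; g)
}.

Section SubcategoryAsCategory.
Variables (C : category) (P : subclass C) (HP : is_subcategory P).

Definition sub_ob := {x : C | sob P x}.
Definition sub_hom (x y : sub_ob) := {f : hom (sval x) (sval y) | smor P f}.
Definition sub_id (x : sub_ob) : sub_hom x x :=
  exist _ (idm (sval x)) (smor_id HP (svalP x)).
Definition sub_cmp (x y z : sub_ob) (f : sub_hom x y) (g : sub_hom y z) :
  sub_hom x z := exist _ (sval f ;; sval g) (smor_cmp HP (svalP f) (svalP g)).

Lemma sub_cmpA w x y z (f : sub_hom w x) (g : sub_hom x y) (h : sub_hom y z) :
  sub_cmp f (sub_cmp g h) = sub_cmp (sub_cmp f g) h.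
Proof. by apply: eq_exist; apply: cmpA. Qed.

Lemma sub_cmp1l x y (f : sub_hom x y) : sub_cmp (sub_id x) f = f.
Proof. by case: f => f Pf; apply: eq_exist; apply: cmp1l. Qed.

Lemma sub_cmp1r x y (f : sub_hom x y) : sub_cmp f (sub_id y) = f.
Proof. by case: f => f Pf; apply: eq_exist; apply: cmp1r. Qed.

Definition subcategory : category := Category sub_cmpA sub_cmp1l sub_cmp1r.

End SubcategoryAsCategory.

Definition choice_of_subobjects (C : category) (P : subclass C) : Prop :=
  exists HP : is_subcategory P,
  [/\ strict_preorder (subcategory HP) /\ sob P = [set: C],
      forall (x y : C) (f : hom x y), smor P f -> monomorphism f
    & forall (x y z : C) (f : hom x z) (g : hom y z) (h : hom x y),
        smor P f -> smor P g -> f = h ;; g -> smor P h].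

Definition category_with_subobjects (C : category) (P : subclass C) : Prop :=
  choice_of_subobjects P.
Arguments category_with_subobjects : clear implicits.

(** * A universe of sets *)

(* "Subspace" is a relation between sets, not between types, and it has to be
   antisymmetric up to equality. The points of a space therefore form a set in
   the sense of set theory: a well-founded tree in Aczel's interpretation,
   taken up to extensional equality. *)
Inductive tree : Type := Tree (A : Type) (f : A -> tree).

Fixpoint tree_eq (s t : tree) : Prop :=
  match s, t with
  | Tree A f, Tree B g =>
      (forall a, exists b, tree_eq (f a) (g b)) /\
      (forall b, exists a, tree_eq (f a) (g b))
  end.

HB.instance Definition _ := gen_eqMixin tree.
HB.instance Definition _ := gen_choiceMixin tree.

Lemma tree_eq_refl t : tree_eq t t.
Proof. by elim: t => A f IH; split=> a; exists a. Qed.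

Lemma tree_eq_sym s t : tree_eq s t -> tree_eq t s.
Proof.
elim: s t => A f IH [B g] /= [fg gf]; split.
  by move=> b; have [a /IH] := gf b; exists a.
by move=> a; have [b /IH] := fg a; exists b.
Qed.

Lemma tree_eq_trans s t u : tree_eq s t -> tree_eq t u -> tree_eq s u.
Proof.
elim: s t u => A f IH [B g] [D h] /= [fg gf] [gh hg]; split.
  by move=> a; have [b fgb] := fg a; have [d] := gh b; exists d; apply: IH fgb _.
by move=> d; have [b ghb] := hg d; have [a fga] := gf b; exists a; apply: IH ghb.
Qed.

Definition tree_eqb (s t : tree) : bool := `[< tree_eq s t >].

Lemma tree_eqb_refl : reflexive tree_eqb.
Proof. by move=> t; apply/asboolP; apply: tree_eq_refl. Qed.

Lemma tree_eqb_sym : symmetric tree_eqb.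
Proof. by move=> s t; apply/asboolP/asboolP; apply: tree_eq_sym. Qed.

Lemma tree_eqb_trans : transitive tree_eqb.
Proof.
move=> t s u /asboolP st /asboolP tu; apply/asboolP.
exact: tree_eq_trans st tu.
Qed.

Canonical tree_equiv :=
  EquivRel tree_eqb tree_eqb_refl tree_eqb_sym tree_eqb_trans.

Definition zset : Type := {eq_quot tree_equiv}%qT.

Definition zset_of (t : tree) : zset := (\pi_({eq_quot tree_equiv}) t)%qT.

Definition elements (X : zset) : set zset :=
  let: Tree A f := repr (X : {eq_quot tree_equiv}%qT) in
  range (zset_of \o f).

Lemma zset_ofP s t : zset_of s = zset_of t <-> tree_eq s t.
Proof.
split=> [st|st]; last by apply/eqmodP/asboolP.
by apply/asboolP; move/eqmodP: st.
Qed.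

Lemma elements_zset_of (A : Type) (f : A -> tree) :
  elements (zset_of (Tree f)) = range (zset_of \o f).
Proof.
rewrite /elements; case E: (repr _) => [B g].
have /zset_ofP /= [gf fg] : zset_of (Tree g) = zset_of (Tree f).
  by rewrite -E /zset_of reprK.
apply/seteqP; split=> _ [a _ <-] /=.
  by have [b ab] := gf a; exists b => //; apply/esym/zset_ofP.
by have [b ab] := fg a; exists b => //; apply/zset_ofP.
Qed.

Lemma elements_inj : injective elements.
Proof.
move=> X Y; rewrite -[X]reprK -[Y]reprK -!/(zset_of _).
case: (repr X) (repr Y) => [A f] [B g]; rewrite !elements_zset_of => fg.
apply/zset_ofP; split=> [a|b].
  have : range (zset_of \o g) (zset_of (f a)) by rewrite -fg; exists a.
  by case=> b _ /esym/zset_ofP; exists b.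
have : range (zset_of \o f) (zset_of (g b)) by rewrite fg; exists b.
by case=> a _ /zset_ofP; exists a.
Qed.

Lemma zset_replacement (A : Type) (f : A -> zset) :
  exists X : zset, elements X = range f.
Proof.
exists (zset_of (Tree (fun a => repr (f a : {eq_quot tree_equiv}%qT)))).
rewrite elements_zset_of; congr (_ @` _); apply/funext => a /=.
exact: reprK.
Qed.

(** * Spaces *)

Record space := Space {
  points : zset;
  opens : set (set (elements points));
  opensT : opens setT;
  opensI : setI_closed opens;
  opensU : forall F : set (set (elements points)),
    F `<=` opens -> opens (\bigcup_(A in F) A)
}.

Definition point (X : space) : Type := elements (points X).
Coercion point : space >-> Sortclass.

Section SpaceTopology.
Variable X : space.

HB.instance Definition _ := gen_eqMixin (point X).
HB.instance Definition _ := gen_choiceMixin (point X).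

Let opens_bigcup (I : Type) (f : I -> set (point X)) :
  (forall i, opens (f i)) -> opens (\bigcup_i f i).
Proof.
move=> fo; suff -> : \bigcup_i f i = \bigcup_(A in range f) A.
  by apply: opensU => _ [i _ <-].
by rewrite bigcup_image.
Qed.

HB.instance Definition _ :=
  isOpenTopological.Build (point X) (@opensT X) (@opensI X) opens_bigcup.

End SpaceTopology.

Lemma open_spaceE (X : space) : (@open X : set (set X)) = @opens X.
Proof.
apply/seteqP; split=> A; rewrite openE /interior /=.
  move=> Ao; suff -> : A = \bigcup_(B in [set B | opens B /\ B `<=` A]) B.
    by apply: opensU => B [].
  apply/seteqP; split=> [x /Ao [B [Bo Bx BA]]|x [B [_ BA]]]; last exact: BA.
  by exists B.
by move=> Ao x Ax; exists A; split.
Qed.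

Definition elements_incl (X Y : zset) (XY : elements X `<=` elements Y)
    (x : elements X) : elements Y :=
  exist _ (val x) (mem_set (XY _ (set_mem (valP x)))).

Record subspace_of (X Y : space) : Prop := SubspaceOf {
  sub_points : elements (points X) `<=` elements (points Y);
  sub_open : @open X =
    [set (elements_incl sub_points : X -> Y) @^-1` O | O in @open Y]
}.

Definition inclusion (X Y : space) (XY : subspace_of X Y) : X -> Y :=
  elements_incl (sub_points XY).

Lemma inclusion_continuous (X Y : space) (XY : subspace_of X Y) :
  continuous (inclusion XY).
Proof.
by apply/continuousP => O Oo; rewrite (sub_open XY); exists O.
Qed.

HB.instance Definition _ (X Y : space) (XY : subspace_of X Y) :=
  isContinuous.Build X Y (inclusion XY) (@inclusion_continuous X Y XY).

(** * Bundles *)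

Record bundle := Bundle {
  total : space;
  base : space;
  bproj : continuousType total base
}.

Record bundle_mor (b b' : bundle) := BundleMor {
  mor_total : continuousType (total b) (total b');
  mor_base : continuousType (base b) (base b');
  mor_proj : @bproj b' \o mor_total = mor_base \o @bproj b
}.

Lemma bundle_mor_eq (b b' : bundle) (m n : bundle_mor b b') :
  mor_total m =1 mor_total n -> mor_base m =1 mor_base n -> m = n.
Proof.
case: m n => u f uf [v g vg] /= uv fg.
have {}uv : u = v by apply/continuousEP.
have {}fg : f = g by apply/continuousEP.
by rewrite uv fg in uf *; congr BundleMor; apply: Prop_irrelevance.
Qed.

Definition bundle_id (b : bundle) : bundle_mor b b :=
  @BundleMor b b idfun idfun erefl.

Lemma bundle_comp_proj (b b' b'' : bundle) (m : bundle_mor b b')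
    (n : bundle_mor b' b'') :
  @bproj b'' \o (mor_total n \o mor_total m) =
  (mor_base n \o mor_base m) \o @bproj b.
Proof. by rewrite compA mor_proj -compA mor_proj compA. Qed.

Definition bundle_comp (b b' b'' : bundle) (m : bundle_mor b b')
    (n : bundle_mor b' b'') : bundle_mor b b'' :=
  @BundleMor b b'' (mor_total n \o mor_total m) (mor_base n \o mor_base m)
    (bundle_comp_proj m n).

Lemma bundle_compA (a b c d : bundle) (f : bundle_mor a b)
    (g : bundle_mor b c) (h : bundle_mor c d) :
  bundle_comp f (bundle_comp g h) = bundle_comp (bundle_comp f g) h.
Proof. exact: bundle_mor_eq. Qed.

Lemma bundle_comp1l (a b : bundle) (f : bundle_mor a b) :
  bundle_comp (bundle_id a) f = f.
Proof. exact: bundle_mor_eq. Qed.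

Lemma bundle_comp1r (a b : bundle) (f : bundle_mor a b) :
  bundle_comp f (bundle_id b) = f.
Proof. exact: bundle_mor_eq. Qed.

Definition Bun : category := Category bundle_compA bundle_comp1l bundle_comp1r.

Record subbundle (b' b : bundle) : Prop := Subbundle {
  sub_total : subspace_of (total b') (total b);
  sub_base : subspace_of (base b') (base b);
  (* [bproj b'] is the restriction of [bproj b] to a map [total b' -> base b'] *)
  sub_proj : @bproj b \o inclusion sub_total = inclusion sub_base \o @bproj b'
}.

Definition subbundle_incl (b' b : bundle) (H : subbundle b' b) :
    bundle_mor b' b :=
  @BundleMor b' b (inclusion (sub_total H)) (inclusion (sub_base H))
    (sub_proj H).

Definition subbundles : subclass Bun := @Subclass Bun [set: bundle]
  (fun b' b => [set m | exists H : subbundle b' b, m = subbundle_incl H]).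

(* Main.v *)
From mathcomp Require Import all_boot.
From mathcomp Require Import all_classical topology.
Require Import Defs.

Set Implicit Arguments.
Unset Strict Implicit.
Unset Printing Implicit Defensive.

Local Open Scope classical_set_scope.

(** An inclusion of spaces is determined by its source and target: it is the
    only map that does not change the underlying element of the universe.  So
    there is at most one subbundle inclusion between two bundles, and any map
    that fixes underlying elements and induces the topology of its source is
    an inclusion ([subspace_of_map], [inclusion_unique]).  Applied to identities
    and composites this gives the subcategory axioms.

    - Antisymmetry: mutual subspaces have the same set of points by
      extensionality, and the inclusion is then the identity, so that the
      topologies agree too; for mutual subbundles the compatibility square
      identifies the projections ([subspace_of_anti], [subbundle_anti]).
    - Inclusions are injective in both components, hence monomorphisms.
    - If [h] followed by an inclusion [g] is an inclusion [f], then [h] fixes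
      underlying elements, since [f] and [g] do; and pulling back along [h]
      the topology that [g] induces yields the one that [f] induces, so [h] is
      an inclusion ([subspace_of_factor], [subbundles_factor]). *)

Lemma val_inclusion (X Y : space) (XY : subspace_of X Y) (x : X) :
  val (inclusion XY x) = val x.
Proof. by []. Qed.

Lemma inclusion_inj (X Y : space) (XY : subspace_of X Y) :
  injective (inclusion XY).
Proof. by move=> x y /(congr1 val); rewrite !val_inclusion => /val_inj. Qed.

Lemma inclusion_unique (X Y : space) (XY : subspace_of X Y) (i : X -> Y) :
  (forall x, val (i x) = val x) -> i = inclusion XY.
Proof. by move=> vi; apply/funext => x; apply: val_inj; rewrite vi. Qed.

Lemma open_subspace (X Y : space) (XY : subspace_of X Y) :
  @open X = [set inclusion XY @^-1` O | O in @open Y].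
Proof. exact: sub_open. Qed.

(** Replaces the specific map [elements_incl] in the definition of a subspace
    by any map with the same underlying elements, so that identities,
    composites and factors can serve as they are. *)
Lemma subspace_of_map (X Y : space) (i : X -> Y) :
  (forall x, val (i x) = val x) ->
  @open X = [set i @^-1` O | O in @open Y] -> subspace_of X Y.
Proof.
move=> vi Xo.
have XY : elements (points X) `<=` elements (points Y).
  move=> x Xx; pose x' : X := exist _ x (mem_set Xx).
  by rewrite -[x]/(val x') -vi; apply: set_mem (valP (i x')).
exists XY; rewrite Xo; suff -> : i = elements_incl XY by [].
by apply/funext => x; apply: val_inj; rewrite vi.
Qed.

Lemma subspace_of_refl (X : space) : subspace_of X X.
Proof.
apply: (@subspace_of_map X X idfun) => //.
by rewrite -[LHS]image_id.
Qed.

Lemma subspace_of_trans (X Y Z : space) :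
  subspace_of X Y -> subspace_of Y Z -> subspace_of X Z.
Proof.
move=> XY YZ; apply: (@subspace_of_map X Z (inclusion YZ \o inclusion XY)) => //.
by rewrite (open_subspace XY) (open_subspace YZ) image_comp.
Qed.

Lemma val_factor (X Y Z : space) (XZ : subspace_of X Z) (YZ : subspace_of Y Z)
    (h : X -> Y) :
  inclusion XZ = inclusion YZ \o h -> forall x, val (h x) = val x.
Proof. by move=> /funeqP hE x; have /(congr1 val) := hE x. Qed.

(** The open sets of [X] are the preimages along [h] of the preimages in [Y] of
    open sets of [Z], and the latter are exactly the open sets of [Y]. *)
Lemma subspace_of_factor (X Y Z : space) (XZ : subspace_of X Z)
    (YZ : subspace_of Y Z) (h : X -> Y) :
  inclusion XZ = inclusion YZ \o h -> subspace_of X Y.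
Proof.
move=> hE; apply: (@subspace_of_map X Y h); first exact: val_factor hE.
by rewrite (open_subspace XZ) (open_subspace YZ) image_comp hE.
Qed.

Lemma subspace_of_anti (X Y : space) :
  subspace_of X Y -> subspace_of Y X -> X = Y.
Proof.
move=> XY YX.
have PQ : points X = points Y.
  by apply: elements_inj; apply/seteqP; split; apply: sub_points.
case: X Y PQ XY YX => [P o oT oI oU] [Q q qT qI qU] /= PQ.
case: Q / PQ q qT qI qU => q qT qI qU XY _.
have oq : o = q.
  have := open_subspace XY; rewrite !open_spaceE /= => ->.
  (* Both spaces have the same set of points, so [id] maps one to the other. *)
  by rewrite -(@inclusion_unique _ _ XY id) //; apply: image_id.
case: q / oq qT qI qU {XY} => qT qI qU.
by congr Space; apply: Prop_irrelevance.
Qed.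

Lemma subbundle_incl_unique (b' b : bundle) (H K : subbundle b' b) :
  subbundle_incl H = subbundle_incl K.
Proof. by congr subbundle_incl; apply: Prop_irrelevance. Qed.

(** The compatibility of inclusions with the projections comes for free from a
    bundle morphism that has these inclusions as components. *)
Lemma subbundles_mor (b' b : bundle) (m : bundle_mor b' b) :
  subspace_of (total b') (total b) -> subspace_of (base b') (base b) ->
  (forall x, val (mor_total m x) = val x) ->
  (forall x, val (mor_base m x) = val x) ->
  smor subbundles (m : @hom Bun b' b).
Proof.
move=> T B vT vB.
have mT := inclusion_unique T vT; have mB := inclusion_unique B vB.
have H : subbundle b' b by exists T B; rewrite -mT -mB; apply: mor_proj.
exists H; apply: bundle_mor_eq => x; apply: val_inj; first exact: vT.
exact: vB.
Qed.

Lemma subbundles_id (b : bundle) : smor subbundles (@idm Bun b).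
Proof. by apply: subbundles_mor => //; apply: subspace_of_refl. Qed.

Lemma subbundles_comp (a b c : Bun) (f : hom a b) (g : hom b c) :
  smor subbundles f -> smor subbundles g -> smor subbundles (f ;; g).
Proof.
move=> [H ->] [K ->]; apply: subbundles_mor => //.
  exact: subspace_of_trans (sub_total H) (sub_total K).
exact: subspace_of_trans (sub_base H) (sub_base K).
Qed.

Lemma subbundles_subcategory : is_subcategory subbundles.
Proof.
split=> // [b _|a b c f g]; [exact: subbundles_id|exact: subbundles_comp].
Qed.

Lemma subbundle_anti (b b' : bundle) :
  subbundle b b' -> subbundle b' b -> b = b'.
Proof.
move=> H K.
have TT := subspace_of_anti (sub_total H) (sub_total K).
have BB := subspace_of_anti (sub_base H) (sub_base K).
case: b b' TT BB H K => [E B p] [E' B' p'] /= TT BB.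
case: E' / TT p' => p'; case: B' / BB p' => p' [T B1 /=].
rewrite -!(@inclusion_unique _ _ _ id) // => /funeqP pp' _.
by congr Bundle; apply/continuousEP => x; rewrite -[LHS]pp'.
Qed.

Lemma subbundle_incl_mono (b' b : Bun) (f : hom b' b) :
  smor subbundles f -> monomorphism f.
Proof.
move=> [H ->] c g h gh; apply: bundle_mor_eq => x.
  apply: (@inclusion_inj _ _ (sub_total H)).
  exact: (congr1 (fun m : bundle_mor c b => mor_total m x) gh).
apply: (@inclusion_inj _ _ (sub_base H)).
exact: (congr1 (fun m : bundle_mor c b => mor_base m x) gh).
Qed.

Lemma subbundles_factor (a b c : Bun) (f : hom a c) (g : hom b c)
    (h : hom a b) :
  smor subbundles f -> smor subbundles g -> f = h ;; g -> smor subbundles h.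
Proof.
move=> [H ->] [K ->] fhg.
have hT : inclusion (sub_total H) = inclusion (sub_total K) \o mor_total h.
  exact: (congr1 (fun m : bundle_mor a c => mor_total m : _ -> _) fhg).
have hB : inclusion (sub_base H) = inclusion (sub_base K) \o mor_base h.
  exact: (congr1 (fun m : bundle_mor a c => mor_base m : _ -> _) fhg).
apply: subbundles_mor.
- exact: subspace_of_factor hT.
- exact: subspace_of_factor hB.
- exact: val_factor hT.
- exact: val_factor hB.
Qed.

Theorem proposition2 : category_with_subobjects Bun subbundles.
Proof.
exists subbundles_subcategory; split.
- split=> //; split=> [p p' [f [H fE]] [g [K gE]]|].
    by apply: eq_exist; rewrite fE gE; apply: subbundle_incl_unique.
  move=> [b []] [b' []] [[f [H _]]] [[g [K _]]].
  by apply: eq_exist; apply: subbundle_anti.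
- exact: subbundle_incl_mono.
- exact: subbundles_factor.
Qed.
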